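(* Let $F$ be a field of characteristic zero and let $\mathcal{T}$ be the free non-symmetric operad over $F$ generated by two binary operations $\prec$ and $\succ$ (concentrated in arity 2). Consider the three elements of $\mathcal{T}(3)$ $$(x\succ y)\prec z - x\succ(y\prec z),$$ $$(x\prec y)\prec z - x\prec(y\prec z) - x\prec(y\succ z),$$ $$(x\succ y)\succ z + (x\prec y)\succ z - x\succ(y\succ z),$$ which are the defining identities of dendriform algebras, and let $(S)$ be the operadic ideal generated by the set $S$ of these three elements, so that $\mathcal{T}/(S)$ is the non-symmetric dendriform operad. Then $S$ is a self-reduced Gröbner–Shirshov basis for the non-symmetric dendriform operad (i.e. of the ideal $(S)$ of $\mathcal{T}$) with respect to the path-lexicographical ordering of tree monomials induced by the order of operations $\prec\; <\; \succ$.
   Context: A dendriform algebra is a vector space with two binary operations $\prec,\succ$ satisfying $(a\succ b)\prec c = a\succ(b\prec c)$, $(a\prec b)\prec c = a\prec(b\prec c)+a\prec(b\succ c)$, $a\succ(b\succ c)=(a\prec b)\succ c+(a\succ b)\succ c$. Tree monomials. The free non-symmetric operad $\mathcal{T}$ on a set $X$ of binary operations has as basis of $\mathcal{T}(n)$ the set of planar rooted binary trees with $n$ leaves whose internal vertices are labelled by elements of $X$ (tree monomials); the operadic compositions graft trees at leaves. The monomial $\mu(x,y)$ is the tree with one internal vertex labelled $\mu$; $\mu(\nu(x,y),z)$ is the tree with root $\mu$ whose left child is an internal vertex labelled $\nu$; $\mu(x,\nu(y,z))$ is the tree with root $\mu$ whose right child is labelled $\nu$ (leaves are read from left to right, so variables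 never change order). In infix notation $x\,\mu\,y=\mu(x,y)$. An operadic ideal is a family of subspaces closed under composition, on either side, with arbitrary elements of the operad. Path-lexicographical order. Fix a total order on $X$. To a tree monomial with $n$ leaves associate the sequence $(w_1,\dots,w_n)$, where $w_i$ is the word in $X$ formed by the labels of the internal vertices met on the path from the root to the $i$-th leaf (leaves ordered from left to right). To compare two tree monomials, first compare the lengths $n$ of their sequences (the longer sequence gives the greater monomial); if equal, compare the sequences word by word from the left, and at the first position where the words differ compare these words degree-lexicographically (longer word is greater; words of equal length are compared lexicographically via the order on $X$); the monomial with the greater word is greater. The leading monomial of a nonzero element is its greatest monomial with nonzero coefficient; the element is monic if that coefficient is 1. Divisibility and reduction. A tree monomial $t$ is divisible by a tree monomial $u$ if $u$ occurs in $t$ as a connected labelled subtree (respecting the left/right planar structure). If $f$ is monic and homogeneous in arity, with leading monomial $u$, and an occurrence of $u$ in $t$ is fixed, let $t[f]$ denote the element obtained from $t$ by replacing this occurrence of $u$ by $f$ (linearly, keeping the rest of $t$ and the trees attached to the leaves of $u$ unchanged); its leading monomial is $t$. A reduction of $g$ with respect to a set $S$ of monic elements replaces $g$ by $g-c\,t[f]$, where $f\in S$ and $t$ is a monomial of $g$ with coefficient $c\neq 0$ divisible by the leading monomial of $f$. Compositions and Gröbner–Shirshov bases. For monic $f,g\in S$ (possibly $f=g$) and a tree monomial $t$ that is the union of an occurrence of the leading monomial of $f$ and an occurrence of the leading monomial of $g$ sharing at least one internal vertex (excluding the case of $f=g$ with identical occurrences), the element $t[f]-t[g]$ is called a composition.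 The set $S$ is a Gröbner–Shirshov basis (of the ideal $(S)$, or of the operad $\mathcal{T}/(S)$) if every composition of elements of $S$ can be reduced to zero with respect to $S$; by the Composition–Diamond Lemma this is equivalent to: the leading monomial of every nonzero element of $(S)$ is divisible by the leading monomial of some element of $S$. It is self-reduced if all its elements are monic and no monomial occurring in an element of $S$ is divisible by the leading monomial of another element of $S$. *)

(* Defs.v *)
From HB Require Import structures.
From Stdlib Require Import Relation_Operators.
From mathcomp Require Import all_boot all_algebra.
From mathcomp.finmap Require Import finmap.
From mathcomp.multinomials Require Import monalg.

Set Implicit Arguments.
Unset Strict Implicit.
Unset Printing Implicit Defensive.

Import GRing.Theory.
Local Open Scope ring_scope.

Inductive tree (X : Type) : Type :=
| Leaf
| Node of X & tree X & tree X.

Arguments Leaf {X}.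
Arguments Node {X}.

Section TreeChoice.
Context {X : choiceType}.

Fixpoint tree_encode (t : tree X) : GenTree.tree X :=
  match t with
  | Leaf => GenTree.Node 0 [::]
  | Node a l r =>
      GenTree.Node 1 [:: GenTree.Leaf a; tree_encode l; tree_encode r]
  end.

Fixpoint tree_decode (s : GenTree.tree X) : option (tree X) :=
  match s with
  | GenTree.Node 0 [::] => Some Leaf
  | GenTree.Node 1 [:: GenTree.Leaf a; s1; s2] =>
      if tree_decode s1 is Some l then
        if tree_decode s2 is Some r then Some (Node a l r) else None
      else None
  | _ => None
  end.

Lemma tree_encodeK : pcancel tree_encode tree_decode.
Proof. by elim=> [|a l IHl r IHr] //=; rewrite IHl IHr. Qed.

HB.instance Definition _ := Choice.copy (tree X) (pcan_type tree_encodeK).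

End TreeChoice.

Section Trees.
Context {X : choiceType}.
Implicit Types (t u v s l r : tree X) (ts : seq (tree X)) (p : seq bool).

Fixpoint leaves t : nat :=
  if t is Node _ l r then (leaves l + leaves r)%N else 1%N.

(* Leaves are numbered from 0, from left to right; [graft_at] is meant to be
   used with [i < leaves t]. *)
Fixpoint graft_at t (i : nat) u : tree X :=
  match t with
  | Leaf => u
  | Node a l r =>
      if (i < leaves l)%N then Node a (graft_at l i u) r
      else Node a l (graft_at r (i - leaves l) u)
  end.

(* Simultaneous grafting of the trees of [ts] at the leaves of [t], from left
   to right; meant to be used with [size ts = leaves t]. *)
Fixpoint graft t ts : tree X :=
  match t with
  | Leaf => head Leaf ts
  | Node a l r =>
      Node a (graft l (take (leaves l) ts)) (graft r (drop (leaves l) ts))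
  end.

(* A position in a tree is the path to it from the root, where [false] stands
   for "go left" and [true] for "go right". *)
Fixpoint subtree t p : option (tree X) :=
  match p, t with
  | [::], _ => Some t
  | b :: p', Node _ l r => subtree (if b then r else l) p'
  | _ :: _, Leaf => None
  end.

Fixpoint replace t p s : tree X :=
  match p, t with
  | [::], _ => s
  | b :: p', Node a l r =>
      if b then Node a l (replace r p' s) else Node a (replace l p' s) r
  | _ :: _, Leaf => Leaf
  end.

(* The positions of the internal vertices. *)
Fixpoint vertices t : seq (seq bool) :=
  if t is Node _ l r then
    [::] :: map (cons false) (vertices l) ++ map (cons true) (vertices r)
  else [::].

(* [u] occurs in [t] with its root at position [p]; [ts] is the list, determined
   by [t], [u] and [p], of the trees attached to the leaves of [u]. *)
Definition occurrence u t p ts : bool :=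
  (size ts == leaves u) && (subtree t p == Some (graft u ts)).

Definition divides u t : Prop := exists p ts, occurrence u t p ts.

Definition occ_vertices u p : seq (seq bool) := [seq p ++ q | q <- vertices u].

Fixpoint path_words t : seq (seq X) :=
  if t is Node a l r then map (cons a) (path_words l ++ path_words r)
  else [:: [::]].

End Trees.

(* Strict lexicographic comparison, only used on sequences of equal sizes. *)
Fixpoint lex_lt (A : eqType) (lt : rel A) (s1 s2 : seq A) : bool :=
  match s1, s2 with
  | x :: s1', y :: s2' => lt x y || (x == y) && lex_lt lt s1' s2'
  | _, _ => false
  end.

Definition deglex_lt (A : eqType) (lt : rel A) (s1 s2 : seq A) : bool :=
  (size s1 < size s2)%N || (size s1 == size s2) && lex_lt lt s1 s2.

(* Here [lt] is the strict order on the operations. *)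
Definition path_lex_lt (X : choiceType) (lt : rel X) (t u : tree X) : bool :=
  deglex_lt (deglex_lt lt) (path_words t) (path_words u).

(* The free non-symmetric operad on binary operations [X], as the direct sum of
   its components; the component of arity [n] is cut out by [homog n]. *)
Notation free_operad F X := {malg F[tree X]}.

Section FreeOperad.
Context {F : fieldType} {X : choiceType}.
Local Notation T := (free_operad F X).

Definition homog (n : nat) (f : T) : Prop :=
  forall t, t \in msupp f -> leaves t = n.

Definition pcomp (f : T) (i : nat) (g : T) : T :=
  \sum_(t <- msupp f) \sum_(u <- msupp g) << f@_t * g@_u *g graft_at t i u >>.

Record operadic_ideal (I : nat -> T -> Prop) : Prop := OperadicIdeal {
  ideal_homog : forall n f, I n f -> homog n f;
  ideal0 : forall n, I n 0;
  idealD : forall n f g, I n f -> I n g -> I n (f + g);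
  idealZ : forall n c f, I n f -> I n (c *: f);
  ideal_compl : forall m n i f g, (i < m)%N ->
    I m f -> homog n g -> I (m + n).-1 (pcomp f i g);
  ideal_compr : forall m n i f g, (i < m)%N ->
    homog m f -> I n g -> I (m + n).-1 (pcomp f i g)
}.

Definition generated_ideal (S : {pred T}) (n : nat) (f : T) : Prop :=
  forall I, operadic_ideal I ->
    (forall m g, g \in S -> homog m g -> I m g) -> I n f.

(* From here on, [lt] is the strict order on the tree monomials. *)

Definition leading (lt : rel (tree X)) (f : T) (u : tree X) : Prop :=
  u \in msupp f /\ forall v, v \in msupp f -> v != u -> lt v u.

Definition monic (lt : rel (tree X)) (f : T) : Prop :=
  exists2 u, leading lt f u & f@_u = 1.

(* The element t[f], for the occurrence in [t] given by [p] and [ts]. *)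
Definition substitute (t : tree X) (p : seq bool) (ts : seq (tree X)) (f : T)
    : T :=
  \sum_(v <- msupp f) << f@_v *g replace t p (graft v ts) >>.

Definition reduction (lt : rel (tree X)) (S : {pred T}) (g g' : T) : Prop :=
  exists f u t p ts,
    [/\ f \in S, leading lt f u, t \in msupp g, occurrence u t p ts
      & g' = g - g@_t *: substitute t p ts f].

Definition reduces (lt : rel (tree X)) (S : {pred T}) : T -> T -> Prop :=
  clos_refl_trans T (reduction lt S).

Definition composition (lt : rel (tree X)) (S : {pred T}) (h : T) : Prop :=
  exists f g u v t p q ts us,
    [/\ f \in S /\ leading lt f u, g \in S /\ leading lt g v,
        occurrence u t p ts /\ occurrence v t q us,
        [/\ vertices t =i occ_vertices u p ++ occ_vertices v q,
            has [in occ_vertices u p] (occ_vertices v q)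
          & ~ (f = g /\ p = q)]
      & h = substitute t p ts f - substitute t q us g].

Record groebner_shirshov_basis (lt : rel (tree X)) (S : {pred T})
    (I : nat -> T -> Prop) : Prop := GroebnerShirshovBasis {
  gsb_homog : forall f, f \in S -> exists n, homog n f;
  gsb_monic : forall f, f \in S -> monic lt f;
  gsb_generates : forall n f, I n f <-> generated_ideal S n f;
  gsb_compositions : forall h, composition lt S h -> reduces lt S h 0
}.

Definition self_reduced (lt : rel (tree X)) (S : {pred T}) : Prop :=
  (forall f, f \in S -> monic lt f) /\
  (forall f g t u, f \in S -> g \in S -> f <> g ->
     t \in msupp f -> leading lt g u -> ~ divides u t).

End FreeOperad.

Inductive dend_op := Prec | Succ.

Definition is_succ (a : dend_op) : bool := if a is Succ then true else false.
Definition dend_op_of (b : bool) : dend_op := if b then Succ else Prec.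

Lemma is_succK : cancel is_succ dend_op_of.
Proof. by case. Qed.

HB.instance Definition _ := Choice.copy dend_op (can_type is_succK).

Definition dend_lt : rel dend_op := fun a b => (a == Prec) && (b == Succ).

Section Dendriform.
Variable F : fieldType.

(* (x a y) b z *)
Definition lcomb (a b : dend_op) : free_operad F dend_op :=
  << Node b (Node a Leaf Leaf) Leaf >>.

(* x a (y b z) *)
Definition rcomb (a b : dend_op) : free_operad F dend_op :=
  << Node a Leaf (Node b Leaf Leaf) >>.

Definition dendriform_relations : seq (free_operad F dend_op) :=
  [:: lcomb Succ Prec - rcomb Succ Prec;
      lcomb Prec Prec - rcomb Prec Prec - rcomb Prec Succ;
      lcomb Succ Succ + lcomb Prec Succ - rcomb Succ Succ].

(* Its quotient is the non-symmetric dendriform operad. *)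
Definition dendriform_ideal : nat -> free_operad F dend_op -> Prop :=
  generated_ideal [in dendriform_relations].

End Dendriform.

Arguments dendriform_relations : clear implicits.
Arguments dendriform_ideal : clear implicits.

(* Main.v *)
Require Import Defs.
From HB Require Import structures.
From Stdlib Require Import Relation_Operators.
From mathcomp Require Import all_boot all_algebra.
From mathcomp.finmap Require Import finmap.
From mathcomp.multinomials Require Import monalg.
From mathcomp Require Import ring.

(** Write x ≺ y and x ≻ y for the two operations.  The path-lexicographical
    order looks first at the leftmost leaf, so that the relations of S, read as
    rewriting rules of their leading monomials, are
      - (x ≻ y) ≺ z --> x ≻ (y ≺ z),
      - (x ≺ y) ≺ z --> x ≺ (y ≺ z) + x ≺ (y ≻ z),
      - (x ≻ y) ≻ z --> x ≻ (y ≻ z) - (x ≺ y) ≻ z.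
    The leading monomials are thus the left combs (x a y) b z with
    (a, b) <> (≺, ≻), each of them leading exactly one relation, and the other
    monomials are right combs or the left comb (x ≺ y) ≻ z.  No left comb with
    two vertices divides a different monomial with two vertices, whence
    self-reducedness.

    A left comb can overlap another one, or itself, only along the left spine
    ([comb_overlap]).  The compositions therefore live on the trees
    ((x a y) b z) c w where both (a, b) and (b, c) are reducible.  There are
    four such triples (a, b, c), and exchanging the two relations only changes
    the sign of the composition ([composition_shape]).

    Each of these four compositions h is a sum [certificate] of terms
    c_i t_i[f_i] with f_i in S, where t_i is the leading monomial of t_i[f_i]
    and does not occur in t_j[f_j] for any j > i.  Such a triangular expression
    is the trace of a reduction of h to zero: the coefficient of t_i in the
    partial sum that starts with the i-th term is c_i, so reducing at t_i removes
    exactly this term ([reduces_step], [reduces_combination]).  All the c_i are 1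
    or -1. *)

Set Implicit Arguments.
Unset Strict Implicit.
Unset Printing Implicit Defensive.

Import GRing.Theory.
Local Open Scope fset_scope.
Local Open Scope ring_scope.

(** * Asymmetry of the path-lexicographical order *)

Lemma lex_lt_asym (A : eqType) (lt : rel A) :
  (forall x y, lt x y -> ~~ lt y x) ->
  forall s1 s2, lex_lt lt s1 s2 -> ~~ lex_lt lt s2 s1.
Proof.
move=> asym; have irr x : lt x x = false.
  by apply/negP => xx; move: (asym _ _ xx); rewrite xx.
elim=> [|x s1 IH] [|y s2] //=; case: (eqVneq x y) => [-> | xy] /=.
  by rewrite irr /=; exact: IH.
by rewrite !orbF; exact: asym.
Qed.

Lemma deglex_lt_asym (A : eqType) (lt : rel A) :
  (forall x y, lt x y -> ~~ lt y x) ->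
  forall s1 s2, deglex_lt lt s1 s2 -> ~~ deglex_lt lt s2 s1.
Proof.
move=> asym s1 s2; rewrite /deglex_lt eq_sym.
by case: ltngtP => //= _; exact: lex_lt_asym.
Qed.

Lemma path_lex_dend_asym t u :
  path_lex_lt dend_lt t u -> ~~ path_lex_lt dend_lt u t.
Proof. by apply/deglex_lt_asym/deglex_lt_asym => -[] []. Qed.

Lemma leading_uniq (F : fieldType) (f : free_operad F dend_op) u v :
  leading (path_lex_lt dend_lt) f u -> leading (path_lex_lt dend_lt) f v ->
  u = v.
Proof.
move=> [fu maxu] [fv maxv]; case: (eqVneq u v) => // uv.
have := maxu v fv; rewrite eq_sym => /(_ uv) /path_lex_dend_asym.
by rewrite maxv.
Qed.

(** * Substitution and reduction in the free operad *)

Section FreeOperad.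
Variables (F : fieldType) (X : choiceType).
Local Notation T := (free_operad F X).
Implicit Types (f g h : T) (t u : tree X).

Section Substitute.
Variables (t : tree X) (p : seq bool) (ts : seq (tree X)).
Local Notation sub := (substitute t p ts).

Lemma substitute_widen (d : {fset tree X}) f : msupp f `<=` d ->
  sub f = \sum_(v <- d) << f@_v *g replace t p (graft v ts) >>.
Proof.
move=> le_fd; apply: big_fset_incl => // v _ /mcoeff_outdom ->.
by rewrite monalgU0.
Qed.

Lemma substituteU u : sub (<< u >> : T) = << replace t p (graft u ts) >>.
Proof. by rewrite (substitute_widen msuppU_le) big_seq_fset1 mcoeffUU. Qed.

Lemma substituteN f : sub (- f) = - sub f.
Proof.
rewrite /substitute msuppN -sumrN; apply: eq_bigr => v _.
by rewrite mcoeffN monalgUN.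
Qed.

Lemma substituteD f g : sub (f + g) = sub f + sub g.
Proof.
rewrite (substitute_widen (msuppD_le f g)).
rewrite (substitute_widen (fsubsetUl (msupp f) (msupp g))).
rewrite (substitute_widen (fsubsetUr (msupp f) (msupp g))) -big_split /=.
by apply: eq_bigr => v _; rewrite mcoeffD monalgUD.
Qed.

End Substitute.

Variables (lt : rel (tree X)) (S : {pred T}).

(** Reducing at a monomial that the rest of a linear combination does not
    contain removes exactly one term of it. *)
Lemma reduces_step c f u t p ts h :
  f \in S -> leading lt f u -> occurrence u t p ts ->
  (substitute t p ts f)@_t = 1 -> h@_t = 0 ->
  reduces lt S h 0 -> reduces lt S (c *: substitute t p ts f + h) 0.
Proof.
move=> fS lfu occ r_t h_t red; have [-> | c0] := eqVneq c 0.
  by rewrite scale0r add0r.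
have coef_t : (c *: substitute t p ts f + h)@_t = c.
  by rewrite mcoeffD mcoeffZ r_t h_t mulr1 addr0.
apply: rt_trans red; apply: rt_step; exists f, u, t, p, ts; split => //.
  by rewrite -mcoeff_neq0 coef_t.
by rewrite coef_t addrAC addrN add0r.
Qed.

Lemma reducesN g h : reduces lt S g h -> reduces lt S (- g) (- h).
Proof.
elim=> {g h} [g h [f [u [t [p [ts [fS lfu gt occ ->]]]]]] | g | g h k _ + _].
- apply: rt_step; exists f, u, t, p, ts; split; rewrite ?msuppN //.
  by rewrite mcoeffN scaleNr opprB opprK addrC.
- exact: rt_refl.
- exact: rt_trans.
Qed.

End FreeOperad.

(** * The dendriform relations and their leading monomials *)

Local Notation "∘" := Leaf.
Local Notation "x ≺ y" := (Node Prec x y) (at level 40, no associativity).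
Local Notation "x ≻ y" := (Node Succ x y) (at level 40, no associativity).

Definition left_comb (a b : dend_op) : tree dend_op :=
  Node b (Node a Leaf Leaf) Leaf.

(** Only the left comb (x ≺ y) ≻ z leads no relation. *)
Definition reducible (a b : dend_op) : bool := is_succ b ==> is_succ a.

Section Relations.
Variable F : fieldType.
Local Notation T := (free_operad F dend_op).
Local Notation lt := (path_lex_lt dend_lt).
Local Notation S := [in dendriform_relations F].

(** Sealed, so that comparing two monomials only compares their trees instead of
    unfolding the representation of formal sums. *)
Fact monomial_key : unit. Proof. exact: tt. Qed.
Definition monomial : tree dend_op -> T :=
  locked_with monomial_key (fun t => << t >>).
Local Notation "''[' t ]" := (monomial t) (at level 0, format "''[' t ]").

Lemma monomialE t : '[t] = << t >>.
Proof. by rewrite /monomial unlock. Qed.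

Lemma substitute_monomial t p ts u :
  substitute t p ts '[u] = '[replace t p (graft u ts)].
Proof. by rewrite !monomialE substituteU. Qed.

Lemma mcoeff_monomial t u : '[u]@_t = (u == t)%:R.
Proof. by rewrite monomialE mcoeffU. Qed.

(** The relation led by (x a y) b z, for a reducible pair (a, b), evaluated at
    three trees inside a context: this form is stable under substitution. *)
Definition relation_in (C : tree dend_op -> tree dend_op) a b x y z : T :=
  match a, b with
  | Succ, Prec => '[C ((x ≻ y) ≺ z)] - '[C (x ≻ (y ≺ z))]
  | Prec, Prec =>
      '[C ((x ≺ y) ≺ z)] - '[C (x ≺ (y ≺ z))] - '[C (x ≺ (y ≻ z))]
  | _, Succ =>
      '[C ((x ≻ y) ≻ z)] + '[C ((x ≺ y) ≻ z)] - '[C (x ≻ (y ≻ z))]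
  end.

Definition relation a b : T := relation_in id a b Leaf Leaf Leaf.

Lemma relationP f :
  f \in S -> exists2 ab, reducible ab.1 ab.2 & f = relation ab.1 ab.2.
Proof.
rewrite !inE => /or3P[] /eqP ->;
  [exists (Succ, Prec) | exists (Prec, Prec) | exists (Succ, Succ)];
  by rewrite // /relation /= !monomialE.
Qed.

Lemma mem_relation a b : reducible a b -> relation a b \in S.
Proof.
by rewrite !inE => red; apply/or3P; case: a b red => [] [] // _;
  [apply: Or32 | apply: Or31 | apply: Or33]; rewrite /relation /= !monomialE.
Qed.

Lemma substitute_relation t p a b x y z :
  substitute t p [:: x; y; z] (relation a b) =
  relation_in (replace t p) a b x y z.
Proof.
by case: a b => [] [];
  rewrite !(substituteD, substituteN, substitute_monomial).
Qed.

(** For (a, b) = (≻, ≺) the last entry does not occur in the relation: only an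
    upper bound of the support is needed, and it is harmless because right combs
    are smaller than left combs and not divisible by them. *)
Definition relation_monomials a b : seq (tree dend_op) :=
  left_comb a b ::
  if b is Succ then [:: left_comb Prec Succ; Leaf ≻ (Leaf ≻ Leaf)]
  else [:: Node a Leaf (Leaf ≺ Leaf); Node a Leaf (Leaf ≻ Leaf)].

Lemma msupp_relation a b t : reducible a b ->
  t \in msupp (relation a b) -> t \in relation_monomials a b.
Proof.
move=> red; apply: contraTT; rewrite -mcoeff_neq0 negbK.
case: a b red => [] [] // _; rewrite /relation_monomials !inE !negb_or;
  case/and3P => t1 t2 t3; rewrite !(mcoeffB, mcoeffD, mcoeff_monomial);
  by rewrite !(eq_sym _ t) (negbTE t1) (negbTE t2) ?(negbTE t3) !subr0 ?addr0.
Qed.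

Lemma relation_monic a b : reducible a b -> (relation a b)@_(left_comb a b) = 1.
Proof.
by case: a b => [] [] // _;
  rewrite !(mcoeffB, mcoeffD, mcoeff_monomial) /= ?subr0 ?addr0.
Qed.

Lemma leading_relation a b :
  reducible a b -> leading lt (relation a b) (left_comb a b).
Proof.
move=> red; split; first by rewrite -mcoeff_neq0 relation_monic ?oner_neq0.
move=> t /(msupp_relation red); rewrite inE => /orP[-> // |].
by case: a b red => [] [] //= _; rewrite !inE => /orP[] /eqP ->.
Qed.

Lemma homog_relation a b : reducible a b -> homog 3 (relation a b).
Proof.
move=> red t /(msupp_relation red).
by case: a b red => [] [] //= _; rewrite !inE => /or3P[] /eqP ->.
Qed.

Lemma monic_relation f : f \in S -> Defs.monic lt f.
Proof.
case/relationP => -[a b] /= red ->.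
by exists (left_comb a b); [exact: leading_relation | exact: relation_monic].
Qed.

Lemma leading_relationP f u : f \in S -> leading lt f u ->
  exists2 ab, reducible ab.1 ab.2 &
    f = relation ab.1 ab.2 /\ u = left_comb ab.1 ab.2.
Proof.
case/relationP => -[a b] /= red -> lu; exists (a, b) => //; split => //.
exact: leading_uniq lu (leading_relation red).
Qed.

(** * Self-reducedness *)

Lemma left_comb_graftP a b (t : tree dend_op) p ts :
  occurrence (left_comb a b) t p ts ->
  exists x y z, ts = [:: x; y; z] /\ subtree t p = Some (Node b (Node a x y) z).
Proof.
by case: ts => [|x [|y [|z []]]] // /andP[_ /eqP st]; exists x, y, z.
Qed.

Lemma divides_relation_monomials a b c d t : reducible c d ->
  t \in relation_monomials a b -> divides (left_comb c d) t ->
  (c, d) = (a, b).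
Proof.
move=> cd tab [p [ts /left_comb_graftP[x [y [z [_]]]]]].
have {tab} : t = left_comb a b \/ t = left_comb Prec Succ \/
    exists a' b', t = Node a' Leaf (Node b' Leaf Leaf).
  move: tab; rewrite inE => /orP[/eqP | ]; first by left.
  case: b => /=; rewrite !inE => /orP[] /eqP ->; right; try by left.
  - by right; exists a, Prec.
  - by right; exists a, Succ.
  - by right; exists Succ, Succ.
(* A proper subtree has at most one vertex, so that [p] is the root. *)
by case=> [|[|[a' [b']]]] -> /=; case: p => [|[] [|[] [|? ?]]] //= [] *;
  subst.
Qed.

Lemma dendriform_self_reduced : self_reduced lt S.
Proof.
split=> [f | f g t u + + fg ft lgu dvd]; first exact: monic_relation.
move=> /relationP[[a b] /= ab ef] /leading_relationP/(_ lgu)[[c d] /= cd [eg eu]].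
apply: fg; rewrite ef eg; rewrite ef in ft; rewrite eu in dvd.
by case: (divides_relation_monomials cd (msupp_relation ab ft) dvd) => -> ->.
Qed.

(** * The compositions *)

Definition left_comb3 (a b c : dend_op) : tree dend_op :=
  Node c (left_comb a b) Leaf.

Lemma vertices_eq0 (t : tree dend_op) : [::] \notin vertices t -> t = Leaf.
Proof. by case: t. Qed.

Lemma mem_vertices_node a (l r : tree dend_op) (d : bool) p :
  (d :: p \in vertices (Node a l r)) = (p \in vertices (if d then r else l)).
Proof.
rewrite /= inE /= mem_cat.
have inj e : injective (cons e : seq bool -> _) by move=> ? ? [].
have neq (e : bool) q s : e != d -> (d :: q \in map (cons e) s) = false.
  by move=> ed; apply/mapP => -[? _ [de]]; rewrite de eqxx in ed.
by case: d neq => neq; [rewrite (neq false) | rewrite (neq true)];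
  rewrite // ?orbF (mem_map (inj _)).
Qed.

(** The only non-root vertex of the upper comb lies on the left edge, so that the
    lower comb has its root there.  As the two combs cover the whole tree, the
    trees attached anywhere else are single leaves. *)
Lemma comb_overlap (t : tree dend_op) a b ts c d q us :
  occurrence (left_comb a b) t [::] ts -> occurrence (left_comb c d) t q us ->
  vertices t =i
    occ_vertices (left_comb a b) [::] ++ occ_vertices (left_comb c d) q ->
  has [in occ_vertices (left_comb a b) [::]] (occ_vertices (left_comb c d) q) ->
  q <> [::] ->
  [/\ d = a, q = [:: false], t = left_comb3 c a b,
      ts = [:: Node c Leaf Leaf; Leaf; Leaf] & us = [:: Leaf; Leaf; Leaf]].
Proof.
move=> /left_comb_graftP[x [y [z [-> t_xyz]]]].
move=> /left_comb_graftP[x' [y' [z' [-> st]]]].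
rewrite /occ_vertices /= => vt meet q0.
have eq : q = [:: false].
  by case: q q0 meet {st vt} => [|[] [|? [|? ?]]].
have et : t = Node b (Node a x y) z.
  by case: (t) t_xyz => //= ? ? ? [-> -> ->].
have [ed ex ey] : [/\ d = a, x = Node c x' y' & y = z'].
  by move: st; rewrite eq et /= => -[-> -> ->].
rewrite eq /= in vt; rewrite {}ex {}ey in et *.
(* All vertices lie on the left spine, at distance at most 2 from the root, so
   that a tree attached anywhere else is a leaf. *)
have leaf p (s : tree dend_op) :
    p \notin [:: [::]; [:: false]; [:: false; false]] ->
    (p \in vertices t) = ([::] \in vertices s) -> s = Leaf.
  by move=> pN E; apply: vertices_eq0; rewrite -E vt; apply: contra pN;
    rewrite !inE => /or4P[] ->; rewrite ?orbT.
have z0 : z = Leaf by apply: (leaf [:: true]); rewrite ?et ?mem_vertices_node.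
have z'0 : z' = Leaf.
  by apply: (leaf [:: false; true]); rewrite ?et ?mem_vertices_node.
have x'0 : x' = Leaf.
  by apply: (leaf [:: false; false; false]); rewrite ?et ?mem_vertices_node.
have y'0 : y' = Leaf.
  by apply: (leaf [:: false; false; true]); rewrite ?et ?mem_vertices_node.
by rewrite et ed eq x'0 y'0 z'0 z0.
Qed.

(** The element t[f] for the relation f whose leading monomial occurs at [p]; it
    is meaningful only if there is one.  The tree and the position determine f,
    which keeps the linear combinations below short. *)
Definition relation_at (t : tree dend_op) (p : seq bool) : T :=
  if subtree t p is Some (Node b (Node a x y) z)
  then relation_in (replace t p) a b x y z else 0.

Definition overlap_composition a b c : T :=
  relation_at (left_comb3 a b c) [::] -
  relation_at (left_comb3 a b c) [:: false].

(** Two combs with the same root have the same labels, hence come from the same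
    relation at the same occurrence, which is excluded; otherwise one of them is
    at the root of [t].  The sign records which one. *)
Lemma composition_shape h : composition lt S h ->
  exists a b c, [/\ reducible a b, reducible b c &
    h = overlap_composition a b c \/ h = - overlap_composition a b c].
Proof.
case=> f [g [u [v [t [p [q [ts [us]]]]]]]].
case=> [[+ +] [+ +] [occ1 occ2] [vt meet fg] ->].
move=> /leading_relationP h1 /h1{h1}[[a b] /= ab [ef eu]].
move=> /leading_relationP h2 /h2{h2}[[c d] /= cd [eg ev]]; subst f g u v.
have pq : p <> q.
  move=> epq; subst q; apply: fg; split=> //.
  have [x [y [z [_ st]]]] := left_comb_graftP occ1.
  by have [x' [y' [z' [_]]]] := left_comb_graftP occ2; rewrite st => -[-> ->].
(* The root of [t] is a vertex of one of the two combs, necessarily its root. *)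
have [p0 | q0] : p = [::] \/ q = [::].
  have : [::] \in vertices t.
    have : p \in vertices t by rewrite vt /occ_vertices /= cats0 inE eqxx.
    by case: (t).
  rewrite vt /occ_vertices /= !inE.
  by case: (p) => [|? ?]; [left | case: (q) => [|? ?]; [right|]].
- subst p; have q0 : q <> [::] by move=> q0; rewrite q0 in pq.
  have [ed eq et ets eus] := comb_overlap occ1 occ2 vt meet q0.
  exists c, a, b; rewrite -{1}ed; split => //; left.
  by subst; rewrite !substitute_relation.
- subst q; have p0 : p <> [::] by [].
  rewrite has_sym in meet.
  have vt' : vertices t =i
    occ_vertices (left_comb c d) [::] ++ occ_vertices (left_comb a b) p.
    by move=> r; rewrite vt !mem_cat orbC.
  have [ed eq et ets eus] := comb_overlap occ2 occ1 vt' meet p0.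
  exists a, c, d; rewrite -{1}ed; split => //; right.
  by subst; rewrite !substitute_relation opprB.
Qed.

(** * Reduction of the compositions to zero *)

Definition redex (t : tree dend_op) (p : seq bool) : bool :=
  if subtree t p is Some (Node b (Node a _ _) _) then reducible a b else false.

Lemma reduces_relation t p c h : redex t p ->
  (relation_at t p)@_t = 1 -> h@_t = 0 -> reduces lt S h 0 ->
  reduces lt S (c *: relation_at t p + h) 0.
Proof.
rewrite /redex /relation_at.
case st: (subtree t p) => [[|b [|a x y] z]|] // ab; rewrite -substitute_relation.
apply: (reduces_step c (mem_relation ab) (leading_relation ab)).
by rewrite /occurrence st /= eqxx.
Qed.

Definition combination (s : seq (F * (tree dend_op * seq bool))) : T :=
  foldr (fun e h => e.1 *: relation_at e.2.1 e.2.2 + h) 0 s.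

(** Cancellations with later terms are excluded, but a leading monomial may
    occur in earlier terms; this is weaker than asking for decreasing leading
    monomials and suffices to reduce from the head on. *)
Fixpoint triangular (s : seq (F * (tree dend_op * seq bool))) : Prop :=
  if s is (_, (t, p)) :: s' then
    [/\ redex t p, (relation_at t p)@_t = 1, (combination s')@_t = 0
      & triangular s']
  else True.

Lemma reduces_combination s : triangular s -> reduces lt S (combination s) 0.
Proof.
elim: s => [_ | [c [t p]] s IHs [rtp rt ct /IHs]]; first exact: rt_refl.
exact: reduces_relation.
Qed.

(** The two reductions of each overlap, continued until they meet.  Write
    x * y = x ≺ y + x ≻ y, so that the relations read
    (x ≻ y) ≺ z = x ≻ (y ≺ z), (x ≺ y) ≺ z = x ≺ (y * z) and
    (x * y) ≻ z = x ≻ (y ≻ z).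
      - ((x ≺ y) ≺ z) ≺ w gives x ≺ ((y * z) * w) and x ≺ (y * (z * w)); their
        difference is x ≺ applied to the sum of the three relations, which is
        the associativity of * (the last three entries).
      - ((x ≻ y) ≺ z) ≺ w gives x ≻ ((y ≺ z) ≺ w) and x ≻ (y ≺ (z * w)).
      - ((x ≻ y) ≻ z) ≺ w gives x ≻ (y ≻ (z ≺ w)) - (x ≺ y) ≻ (z ≺ w) on both
        sides.
      - ((x ≻ y) ≻ z) ≻ w compares the computations of ((x * y) * z) ≻ w and of
        (x * (y * z)) ≻ w, both equal to x ≻ (y ≻ (z ≻ w)).
    An entry records the sign, the monomial that is reduced and the position of
    the left comb in it. *)
Definition certificate (a b c : dend_op) : seq (F * (tree dend_op * seq bool)) :=
  match a, b, c with
  | Prec, Prec, Prec =>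
      [:: (1, ((∘ ≺ (∘ ≺ ∘)) ≺ ∘, [::]));
          (1, ((∘ ≺ (∘ ≻ ∘)) ≺ ∘, [::]));
          (-1, ((∘ ≺ ∘) ≺ (∘ ≺ ∘), [::]));
          (-1, ((∘ ≺ ∘) ≺ (∘ ≻ ∘), [::]));
          (1, (∘ ≺ ((∘ ≺ ∘) ≺ ∘), [:: true]));
          (1, (∘ ≺ ((∘ ≻ ∘) ≺ ∘), [:: true]));
          (1, (∘ ≺ ((∘ ≻ ∘) ≻ ∘), [:: true]))]
  | Succ, Prec, Prec =>
      [:: (1, ((∘ ≻ (∘ ≺ ∘)) ≺ ∘, [::]));
          (-1, ((∘ ≻ ∘) ≺ (∘ ≺ ∘), [::]));
          (-1, ((∘ ≻ ∘) ≺ (∘ ≻ ∘), [::]));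
          (1, (∘ ≻ ((∘ ≺ ∘) ≺ ∘), [:: true]))]
  | Succ, Succ, Prec =>
      [:: (-1, ((∘ ≻ ∘) ≻ (∘ ≺ ∘), [::]));
          (-1, (((∘ ≺ ∘) ≻ ∘) ≺ ∘, [::]));
          (1, ((∘ ≻ (∘ ≻ ∘)) ≺ ∘, [::]));
          (1, (∘ ≻ ((∘ ≻ ∘) ≺ ∘), [:: true]))]
  | _, _, _ =>
      [:: (1, (((∘ ≻ ∘) ≺ ∘) ≻ ∘, [:: false]));
          (-1, ((∘ ≻ ∘) ≻ (∘ ≻ ∘), [::]));
          (-1, (((∘ ≺ ∘) ≻ ∘) ≻ ∘, [::]));
          (1, ((∘ ≻ (∘ ≻ ∘)) ≻ ∘, [::]));
          (1, ((∘ ≻ (∘ ≺ ∘)) ≻ ∘, [::]));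
          (1, (((∘ ≺ ∘) ≺ ∘) ≻ ∘, [:: false]));
          (1, (∘ ≻ ((∘ ≻ ∘) ≻ ∘), [:: true]))]
  end.

Lemma overlap_compositionE a b c : reducible a b -> reducible b c ->
  overlap_composition a b c = combination (certificate a b c).
Proof.
move=> ab bc; apply/malgP => t; case: a b c ab bc => [] [] [] // _ _;
  rewrite /overlap_composition /combination /relation_at /=;
  by rewrite !(mcoeffB, mcoeffD, mcoeffZ, mcoeff0); ring.
Qed.

Lemma certificate_triangular a b c : reducible a b -> reducible b c ->
  triangular (certificate a b c).
Proof.
case: a b c => [] [] [] // _ _; rewrite /= /relation_at /=;
  do !split;
  by rewrite !(mcoeffB, mcoeffD, mcoeffZ, mcoeff0, mcoeff_monomial) /=; ring.
Qed.

Lemma dendriform_compositions h : composition lt S h -> reduces lt S h 0.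
Proof.
move=> /composition_shape[a [b [c [ab bc]]]].
have red : reduces lt S (overlap_composition a b c) 0.
  rewrite overlap_compositionE //; apply: reduces_combination.
  exact: certificate_triangular.
by case=> -> //; rewrite -[0]oppr0; exact: reducesN.
Qed.

End Relations.

Theorem theorem1 (F : fieldType) (hF : [pchar F]%R =i pred0) :
  self_reduced (path_lex_lt dend_lt) [in dendriform_relations F] /\
  groebner_shirshov_basis (path_lex_lt dend_lt) [in dendriform_relations F]
    (dendriform_ideal F).
Proof.
split; first exact: dendriform_self_reduced.
split=> //; last exact: dendriform_compositions.
- by move=> f /relationP[[a b] /= ab ->]; exists 3; exact: homog_relation.
- exact: monic_relation.
Qed.
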